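(* Let $X$ be a first countable Hausdorff space, let $x=(x_n)_{n\in\mathbf{N}}$ be a sequence taking values in $X$, and let $\mathcal{I}_\varphi$ be an analytic P-ideal on $\mathbf{N}$, represented by a lower semicontinuous submeasure $\varphi$ with $\varphi(\mathbf{N})<\infty$ as $\mathcal{I}_\varphi=\{A\subseteq\mathbf{N}:\|A\|_\varphi=0\}$. For each $\ell\in X$ let $$\mathfrak{u}(\ell):=\lim_{k\to\infty}\|\{n: x_n\in U_k\}\|_\varphi,$$ where $(U_k)$ is a decreasing local base of neighborhoods at $\ell$. Then $$\Lambda_x(\mathcal{I}_\varphi)=\{\ell\in X:\mathfrak{u}(\ell)>0\}.$$ In particular, $\Lambda_x(\mathcal{I}_\varphi)$ is an $F_\sigma$-set.
   Context: $\mathbf{N}$ denotes the positive integers. An ideal $\mathcal{I}$ on $\mathbf{N}$ is a collection of subsets of $\mathbf{N}$ closed under finite unions and subsets; it is assumed to contain the family $\mathrm{Fin}$ of finite subsets of $\mathbf{N}$ and to be different from $\mathcal{P}(\mathbf{N})$. A map $\varphi:\mathcal{P}(\mathbf{N})\to[0,\infty]$ is a lower semicontinuous submeasure if $\varphi(\emptyset)=0$; $\varphi(A)\le\varphi(B)$ whenever $A\subseteq B$; $\varphi(A\cup B)\le\varphi(A)+\varphi(B)$ for all $A,B$; and $\varphi(A)=\lim_n\varphi(A\cap\{1,\ldots,n\})$ for all $A$. Put $\|A\|_\varphi:=\lim_n\varphi(A\setminus\{1,\ldots,n\})$. By a theorem of Solecki, an ideal $\mathcal{I}$ on $\mathbf{N}$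 is an analytic P-ideal if and only if $\mathcal{I}=\mathcal{I}_\varphi:=\{A\subseteq\mathbf{N}:\|A\|_\varphi=0\}$ for some lower semicontinuous submeasure $\varphi$ with $\varphi(\mathbf{N})<\infty$; an analytic P-ideal is always written as $\mathcal{I}_\varphi$ for such a fixed $\varphi$. $\Lambda_x(\mathcal{I})$ is the set of $\mathcal{I}$-limit points of $x$: the set of all $\ell\in X$ such that $\lim_{k\to\infty}x_{n_k}=\ell$ for some subsequence $(x_{n_k})$ with $\{n_k:k\in\mathbf{N}\}\notin\mathcal{I}$. The limit defining $\mathfrak{u}(\ell)$ exists and does not depend on the choice of $(U_k)$. *)

(* Defs.v *)
From HB Require Import structures.
From mathcomp Require Import all_boot all_order all_algebra.
From mathcomp Require Import all_classical all_reals all_analysis.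

Set Implicit Arguments.
Unset Strict Implicit.
Unset Printing Implicit Defensive.

Import Order.TTheory GRing.Theory Num.Theory.
Import numFieldNormedType.Exports.

Local Open Scope classical_set_scope.
Local Open Scope ring_scope.
Local Open Scope ereal_scope.

(* The positive integers are enumerated by [nat], k standing for k + 1;
   the initial segment {1, ..., n} is then [`I_n = [set k | k < n]]. *)

Record ideal (I : set (set nat)) : Prop := Ideal {
  ideal_sub : forall A B : set nat, A `<=` B -> I B -> I A ;
  idealU : forall A B : set nat, I A -> I B -> I (A `|` B) ;
  ideal_fin : forall A : set nat, finite_set A -> I A ;
  ideal_proper : I <> setT }.

Record lsc_submeasure (R : realType) (phi : set nat -> \bar R) : Prop :=
  LscSubmeasure {
  submeasure_ge0 : forall A : set nat, 0 <= phi A ;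
  submeasure0 : phi set0 = 0 ;
  submeasure_le : forall A B : set nat, A `<=` B -> phi A <= phi B ;
  submeasureU : forall A B : set nat, phi (A `|` B) <= phi A + phi B ;
  submeasure_lsc :
    forall A : set nat, phi (A `&` `I_n) @[n --> \oo] --> phi A }.

Definition submeasure_norm (R : realType) (phi : set nat -> \bar R)
    (A : set nat) : \bar R :=
  limn (fun n => phi (A `\` `I_n)).

Definition submeasure_ideal (R : realType) (phi : set nat -> \bar R) :
    set (set nat) :=
  [set A | submeasure_norm phi A = 0].

Definition first_countable (X : topologicalType) : Prop :=
  forall l : X, exists B : set (set X),
    [/\ countable B, B `<=` nbhs l &
        forall V, nbhs l V -> exists2 W, B W & W `<=` V].

Definition decreasing_local_base (X : topologicalType) (l : X)
    (U : nat -> set X) : Prop :=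
  [/\ forall k, nbhs l (U k), forall k, U k.+1 `<=` U k &
      forall V, nbhs l V -> exists k, U k `<=` V].

Definition limit_points (X : topologicalType) (I : set (set nat))
    (x : nat -> X) : set X :=
  [set l | exists s : nat -> nat,
    [/\ {homo s : i j / (i < j)%N}, ~ I (range s) &
        x (s k) @[k --> \oo] --> l]].

(* The number u(l), computed along U, a decreasing local base at l. *)
Definition limit_mass (R : realType) (phi : set nat -> \bar R)
    (X : topologicalType) (x : nat -> X) (U : nat -> set X) : \bar R :=
  limn (fun k => submeasure_norm phi [set n | U k (x n)]).

(* [limn] is a total operator: the limits above do exist, and [limit_mass] does
   not depend on the choice of the local base. *)
Section limits_exist.
Context (R : realType) (phi : set nat -> \bar R) (phiP : lsc_submeasure phi).

Lemma is_cvg_submeasure_norm (A : set nat) : cvgn (fun n => phi (A `\` `I_n)).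
Proof.
apply: ereal_nonincreasing_is_cvgn => m n mn.
apply: (submeasure_le phiP) => k [Ak /= nk]; split=> //= km.
by apply: nk; exact: leq_trans mn.
Qed.

Lemma le_submeasure_norm (A B : set nat) :
  A `<=` B -> submeasure_norm phi A <= submeasure_norm phi B.
Proof.
move=> AB; apply: lee_lim; [exact: is_cvg_submeasure_norm..|].
by apply: nearW => n; apply: (submeasure_le phiP); exact: setSD.
Qed.

Lemma is_cvg_limit_mass (X : topologicalType) (x : nat -> X) (l : X)
    (U : nat -> set X) : decreasing_local_base l U ->
  cvgn (fun k => submeasure_norm phi [set n | U k (x n)]).
Proof.
case=> _ Ud _; apply: ereal_nonincreasing_is_cvgn.
apply/nonincreasing_seqP => k; apply: le_submeasure_norm => n /=; exact: Ud.
Qed.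

Lemma limit_mass_indep (X : topologicalType) (x : nat -> X) (l : X)
    (U V : nat -> set X) :
  decreasing_local_base l U -> decreasing_local_base l V ->
  limit_mass phi x U = limit_mass phi x V.
Proof.
have le_mass (U' V' : nat -> set X) : decreasing_local_base l U' ->
    decreasing_local_base l V' -> limit_mass phi x U' <= limit_mass phi x V'.
  move=> bU bV; apply: lime_ge; first exact: is_cvg_limit_mass bV.
  apply: nearW => k; have [nV _ _] := bV; have [_ Ud Us] := bU.
  have [j UjVk] := Us _ (nV k).
  apply: lime_le; first exact: is_cvg_limit_mass bU.
  exists j => // i /= ji; apply: le_submeasure_norm => n /= Uixn; apply: UjVk.
  have /nonincreasing_seqP Ud' : forall k, (U' k >= U' k.+1)%O.
    by move=> ?; rewrite subsetEset; exact: Ud.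
  by have := Ud' _ _ ji; rewrite subsetEset; exact.
by move=> bU bV; apply/eqP; rewrite eq_le !le_mass.
Qed.
End limits_exist.

Lemma first_countable_base (X : topologicalType) (l : X) :
  first_countable X -> exists U, decreasing_local_base l U.
Proof.
move=> /(_ l)[B [Bc Bl Bb]].
have [W0 BW0 _] := Bb setT filterT.
have [f fB] : exists f : nat -> set X, range f = B.
  have /pfcard_geP[B0|/unsquash f] := Bc; first by move: BW0; rewrite B0.
  by exists f; exact: image_eq.
exists (fun k => \bigcap_(i < k.+1) f i); split.
- move=> k; elim: k => [|k IHk].
    by rewrite bigcap_mkord big_ord1; apply: Bl; rewrite -fB; exists 0%N.
  rewrite bigcap_mkord big_ord_recr /= -bigcap_mkord; apply: filterI => //.
  by apply: Bl; rewrite -fB; exists k.+1.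
- by move=> k y fy i /= ik; apply: fy => /=; exact: ltnW.
- move=> V /Bb[W]; rewrite -fB => -[k _ <-] fkV; exists k => y fy.
  by apply: fkV; apply: fy => /=.
Qed.

(* Main.v *)
Require Import Defs.
From HB Require Import structures.
From mathcomp Require Import all_boot all_order all_algebra.
From mathcomp Require Import all_classical all_reals all_analysis.
From mathcomp Require Import borel_hierarchy.

(* Fix a decreasing local base U_k at l and put A_k = {n : x_n in U_k}.  If
   x_{n_k} --> l, then {n_k} is contained in every A_k up to a finite set, so
   u(l) is at least the norm of {n_k}.  Conversely, if u(l) > c > 0, then every
   tail of every A_k has phi-value above c, and by lower semicontinuity so has a
   finite piece of it; consecutive finite pieces of A_0, A_1, ... glue to a set
   of norm at least c along which x converges to l.  Finally, u(l) >= c means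
   that {n : x_n in V} has norm at least c for every neighborhood V of l, which
   is a closed condition on l. *)

Set Implicit Arguments.
Unset Strict Implicit.
Unset Printing Implicit Defensive.

Import Order.TTheory GRing.Theory Num.Theory.
Import numFieldNormedType.Exports.

Local Open Scope classical_set_scope.
Local Open Scope ring_scope.
Local Open Scope ereal_scope.

Lemma lt0e_natSinv (R : realType) (u : \bar R) :
  0 < u -> exists j : nat, (j.+1%:R^-1)%:E < u.
Proof.
case: u => [r| |] // r0; last by exists 0%N; rewrite ltry.
have {}r0 : (0 < r)%R by rewrite -lte_fin.
have [N _ /(_ N (leqnn N))/= rN] := near_infty_natSinv_lt (PosNum r0).
by exists N; rewrite lte_fin.
Qed.

Lemma homo_ltn_ge_id (s : nat -> nat) :
  {homo s : i j / (i < j)%N} -> forall k, (k <= s k)%N.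
Proof. by move=> sh; elim=> // k IH; exact: leq_ltn_trans IH (sh _ _ _). Qed.

(** Each value of [s] is the least element of [A] past the previous one, so no element of [A] is
    skipped. *)
Lemma nat_unbounded_enum (A : set nat) :
  (forall n, exists2 m, (n <= m)%N & A m) ->
  exists2 s : nat -> nat, {homo s : i j / (i < j)%N} & range s = A.
Proof.
move=> Aoo.
have /choice[f fP] n : exists m, [/\ (n <= m)%N, A m &
    forall i, A i -> (n <= i)%N -> (m <= i)%N].
  have [|m [[nm Am] mmin]] := @nat_has_minimum [set m | (n <= m)%N /\ A m].
    by have [m nm Am] := Aoo n; exists m.
  by exists m; split=> // i Ai ni; exact: mmin.
pose s := fix s k := if k is k'.+1 then f (s k').+1 else f 0%N.
have ss k : (s k < s k.+1)%N by have [] := fP (s k).+1.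
have sh : {homo s : i j / (i < j)%N} by apply: homo_ltn => //; exact: ltn_trans.
exists s => //; apply/seteqP; split=> [_ [k _ <-]|a Aa].
  by case: k => [|k]; [have [] := fP 0%N | have [] := fP (s k).+1].
have [k] : exists k, (a <= s k)%N by exists a; exact: homo_ltn_ge_id.
elim: k => [|k IH] ask.
  exists 0%N => //; apply/eqP; rewrite eqn_leq ask andbT.
  by have [_ _] := fP 0%N; apply.
have [/IH//|ska] := leqP a (s k).
exists k.+1 => //; apply/eqP; rewrite eqn_leq ask andbT.
by have [_ _] := fP (s k).+1; apply.
Qed.

Section submeasure.
Context (R : realType) (phi : set nat -> \bar R) (phiP : lsc_submeasure phi).
Implicit Types (A B : set nat) (c : \bar R).

(** The values on tails are nonincreasing, so their limit is their infimum. *)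
Lemma submeasure_norm_leP c A :
  c <= submeasure_norm phi A <-> forall n, c <= phi (A `\` `I_n).
Proof.
split=> [cA n|cA]; last first.
  by apply: lime_ge; [exact: is_cvg_submeasure_norm|exact: nearW].
apply: le_trans cA _; apply: lime_le; first exact: is_cvg_submeasure_norm.
exists n => // m /= nm; apply: (submeasure_le phiP) => k [Ak /= mk].
by split=> //= kn; apply: mk; exact: leq_trans nm.
Qed.

Lemma le_submeasure_norm_almost A B N :
  A `\` `I_N `<=` B -> submeasure_norm phi A <= submeasure_norm phi B.
Proof.
move=> AB; apply/submeasure_norm_leP => n.
have /submeasure_norm_leP/(_ (maxn n N)) := lexx (submeasure_norm phi A).
move=> /le_trans; apply; apply: (submeasure_le phiP) => k [Ak /= /negP].
rewrite -leqNgt geq_max => /andP[nk Nk]; split.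
  by apply: AB; split=> //=; apply/negP; rewrite -leqNgt.
by apply/negP; rewrite -leqNgt.
Qed.

(** If every finite piece had value at most [c], so would their limit [phi A]. *)
Lemma submeasure_lt_finite c A :
  c < phi A -> exists m, c < phi (A `&` `I_m).
Proof.
move=> cA; apply: contrapT => /forallNP Ac; move: cA; rewrite ltNge => /negP.
apply; apply: cvge_le (submeasure_lsc phiP (A:=A)).
by apply: nearW => m; rewrite leNgt; apply/negP.
Qed.

Lemma submeasure_glue c (A : nat -> set nat) : 0 <= c ->
  (forall k, c < submeasure_norm phi (A k)) ->
  exists (N : nat -> nat) B,
    [/\ {homo N : i j / (i < j)%N}, c <= submeasure_norm phi B &
        forall i, B i -> exists k, (N k <= i < N k.+1)%N /\ A k i].
Proof.
move=> c0 cA.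
(* The pair [p] holds the index of a set and the start of a block; [m] is the end of the block. *)
have /choice[f fP] (p : nat * nat) :
    exists m, c < phi ((A p.1 `\` `I_p.2) `&` `I_m).
  apply: submeasure_lt_finite; apply: lt_le_trans (cA p.1) _.
  exact: (submeasure_norm_leP _ _).1 (lexx _) _.
pose N := fix N k := if k is k'.+1 then f (k', N k') else 0%N.
have cN k : c < phi ((A k `\` `I_(N k)) `&` `I_(N k.+1)) by exact: fP (k, N k).
have Nh : {homo N : i j / (i < j)%N}.
  apply: homo_ltn; first exact: ltn_trans.
  (* A block that did not advance would be empty, of value 0, hence not above [c]. *)
  move=> k; rewrite ltnNge; apply/negP => Nk; have := cN k.
  suff -> : (A k `\` `I_(N k)) `&` `I_(N k.+1) = set0.
    by rewrite (submeasure0 phiP) ltNge c0.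
  by rewrite -subset0 => i [[_ /= iN] iN']; apply: iN; exact: leq_trans Nk.
exists N, [set i | exists k, (N k <= i < N k.+1)%N /\ A k i]; split=> //.
(* Since [n <= N n], the tail of the glued set from [n] on contains its whole [n]-th block. *)
apply/submeasure_norm_leP => n; apply: le_trans (ltW (cN n)) _.
apply: (submeasure_le phiP) => i [[Ai /= /negP]]; rewrite -leqNgt => Ni iN.
split; first by exists n; rewrite Ni.
by apply/negP; rewrite -leqNgt; apply: leq_trans Ni; exact: homo_ltn_ge_id.
Qed.

Section limit_points.
Context (X : topologicalType) (x : nat -> X).

(** Removes the base from the bound, leaving a condition that can be compared between nearby
    points. *)
Lemma limit_mass_leP l (U : nat -> set X) c : decreasing_local_base l U ->
  c <= limit_mass phi x U <->
  forall V, nbhs l V -> c <= submeasure_norm phi (x @^-1` V).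
Proof.
move=> bU; have [nU Ud Us] := bU; split=> [cU V /Us[k UkV]|cV]; last first.
  apply: lime_ge; first exact: is_cvg_limit_mass bU.
  by apply: nearW => k; exact: cV (nU k).
apply: le_trans cU _; apply: lime_le; first exact: is_cvg_limit_mass bU.
exists k => // i /= ki; apply: le_submeasure_norm => // n /= Uixn; apply: UkV.
elim: i ki Uixn => [|i IH]; first by rewrite leqn0 => /eqP ->.
by rewrite leq_eqVlt => /predU1P[<-//|/IH Uk /Ud].
Qed.

Lemma limit_points_mass_gt0 l (U : nat -> set X) : decreasing_local_base l U ->
  limit_points (submeasure_ideal phi) x l <-> 0 < limit_mass phi x U.
Proof.
move=> bU; have [nU Ud Us] := bU; split=> [[s [sh sI sl]]|].
  apply: (@lt_le_trans _ _ (submeasure_norm phi (range s))).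
    rewrite lt_def; apply/andP; split; first exact/eqP.
    by apply/submeasure_norm_leP => n; exact: submeasure_ge0.
  apply/(limit_mass_leP _ bU) => V /sl[K _ KV].
  apply: (@le_submeasure_norm_almost _ _ (s K)) => _ [[k _ <-] /= /negP].
  rewrite -leqNgt => sKk; apply: KV => /=; rewrite leqNgt; apply/negP => /sh.
  by rewrite ltnNge sKk.
(* Gluing needs a bound strictly below the norms of all the sets, hence a [c] strictly below the
   mass. *)
move=> /lt0e_natSinv[j]; set c := _%:E => cU.
have c0 : 0 < c by rewrite lte_fin invr_gt0 ltr0n.
have [||N [B [Nh cB BN]]] := @submeasure_glue c (fun k => x @^-1` U k).
- exact: ltW.
- move=> k; apply: lt_le_trans cU _.
  exact: (limit_mass_leP _ bU).1 (lexx _) _ (nU k).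
(* [B] is unbounded: an empty tail would have value 0, below [c]. *)
have [n|s sh sB] := @nat_unbounded_enum B.
  apply: contrapT => /forall2NP Bn.
  have /submeasure_norm_leP/(_ n) := cB.
  suff -> : B `\` `I_n = set0 by rewrite (submeasure0 phiP) leNgt c0.
  rewrite -subset0 => i [Bi /= /negP]; rewrite -leqNgt => ni.
  by case: (Bn i).
exists s; split => //.
  by rewrite sB /submeasure_ideal /= => B0; move: cB; rewrite B0 leNgt c0.
(* For [i >= N k] also [s i >= N k], so the block containing [s i] has index [m >= k], and [U m]
   lies in [U k]. *)
move=> V /Us[k UkV]; exists (N k) => // i /= Nki; apply: UkV.
have [m [/andP[_ sm] Um]] : exists m, (N m <= s i < N m.+1)%N /\ U m (x (s i)).
  by apply: BN; rewrite -sB; exists i.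
have km : (k <= m)%N.
  rewrite leqNgt; apply/negP => mk.
  have : (N k < N k)%N; last by rewrite ltnn.
  apply: leq_ltn_trans (leq_trans Nki (homo_ltn_ge_id sh i)) _.
  apply: leq_trans sm _; move: mk; rewrite leq_eqVlt => /predU1P[->//|/Nh].
  exact: ltnW.
elim: m km Um {sm} => [|m IH]; first by rewrite leqn0 => /eqP ->.
by rewrite leq_eqVlt => /predU1P[<-//|/IH Uk /Ud].
Qed.

(** A neighborhood [V] of a closure point has a point of the set in its interior, and [V] is a
    neighborhood of that point too. *)
Lemma closed_limit_mass_ge c :
  closed [set l | forall V, nbhs l V -> c <= submeasure_norm phi (x @^-1` V)].
Proof.
move=> l cl V lV; have [l' [l'c Vl']] := cl _ (nbhs_interior lV).
exact: l'c Vl'.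
Qed.

Lemma Fsigma_limit_points : first_countable X ->
  Fsigma (limit_points (submeasure_ideal phi) x).
Proof.
move=> X1; pose c (j : nat) : \bar R := (j.+1%:R^-1)%:E.
(* Positive mass means mass at least [1/(j+1)] for some [j]: a countable union of closed
   conditions. *)
exists (fun j =>
  [set l | forall V, nbhs l V -> c j <= submeasure_norm phi (x @^-1` V)]).
  by move=> j; exact: closed_limit_mass_ge.
apply/seteqP; split=> l; have [U bU] := first_countable_base l X1.
  move=> /(limit_points_mass_gt0 bU)/lt0e_natSinv[j jU]; exists j => //=.
  exact/(limit_mass_leP _ bU)/ltW.
move=> [j _ /= /(limit_mass_leP _ bU) jU]; apply/(limit_points_mass_gt0 bU).
by apply: lt_le_trans jU; rewrite lte_fin invr_gt0 ltr0n.
Qed.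

End limit_points.
End submeasure.

Theorem theorem2p2 (R : realType) (X : topologicalType)
    (X_first_countable : first_countable X) (X_hausdorff : hausdorff_space X)
    (x : nat -> X) (phi : set nat -> \bar R) (phi_lsc : lsc_submeasure phi)
    (phi_fin : phi setT < +oo) (phi_ideal : ideal (submeasure_ideal phi)) :
  (forall U : X -> nat -> set X,
     (forall l : X, decreasing_local_base l (U l)) ->
     limit_points (submeasure_ideal phi) x =
       [set l | 0 < limit_mass phi x (U l)]) /\
  Fsigma (limit_points (submeasure_ideal phi) x).
Proof.
split; last exact: Fsigma_limit_points.
move=> U bU; apply/seteqP; split=> l.
  by move/(limit_points_mass_gt0 phi_lsc x (bU l)).
by move=> ?; apply/(limit_points_mass_gt0 phi_lsc x (bU l)).
Qed.
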